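(* Let $n\geqslant 11$, $\alpha\in[0,\frac34]$, and let $G$ be a graph having the minimum $A_\alpha$-index among all connected graphs of order $n$ with independence number $2$. Then $G\cong F(\lceil n/2\rceil,\lfloor n/2\rfloor)$.
   Context: All graphs are finite, simple and connected. For a graph $G$ with adjacency matrix $A(G)$ and diagonal degree matrix $D(G)$, and $\alpha\in[0,1]$, $A_\alpha(G)=\alpha D(G)+(1-\alpha)A(G)$; the $A_\alpha$-index is its largest eigenvalue. For positive integers $s,t$, $F(s,t)=(K_{s,t}-e)^c$ is the complement of the complete bipartite graph $K_{s,t}$ with one edge removed; equivalently, it is the disjoint union of $K_s$ and $K_t$ together with one edge joining a vertex $u$ of $K_s$ to a vertex $v$ of $K_t$. *)

(* Defs.v *)
From HB Require Import structures.
From mathcomp Require Import all_boot all_order all_algebra.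
From mathcomp Require Import reals.

Set Implicit Arguments.
Unset Strict Implicit.
Unset Printing Implicit Defensive.

Import Order.TTheory GRing.Theory Num.Theory.
Local Open Scope ring_scope.

Record sgraph (T : finType) := SGraph {
  adj :> rel T;
  adj_sym : symmetric adj;
  adj_irrefl : irreflexive adj }.

Section Graphs.
Context {T : finType}.
Implicit Types G : sgraph T.

Definition connected G : Prop := forall x y : T, connect G x y.

Definition stable G (S : {set T}) : bool :=
  [forall x in S, forall y in S, ~~ G x y].

Definition independence_number G : nat := (\max_(S : {set T} | stable G S) #|S|)%N.

Definition degree G (x : T) : nat := #|[set y | G x y]|.

Fact complement_sym G : symmetric [rel x y : T | (x != y) && ~~ G x y].
Proof. by move=> x y /=; rewrite eq_sym adj_sym. Qed.

Fact complement_irrefl G : irreflexive [rel x y : T | (x != y) && ~~ G x y].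
Proof. by move=> x /=; rewrite eqxx. Qed.

Definition complement G : sgraph T :=
  SGraph (complement_sym G) (complement_irrefl G).

Fact remove_edges_sym G (P : rel T) :
  symmetric [rel x y : T | G x y && ~~ (P x y || P y x)].
Proof. by move=> x y /=; rewrite adj_sym orbC. Qed.

Fact remove_edges_irrefl G (P : rel T) :
  irreflexive [rel x y : T | G x y && ~~ (P x y || P y x)].
Proof. by move=> x /=; rewrite adj_irrefl. Qed.

(* The edges xy with P x y or P y x are removed; the vertices are kept. *)
Definition remove_edges G (P : rel T) : sgraph T :=
  SGraph (remove_edges_sym G P) (remove_edges_irrefl G P).

End Graphs.

Definition isomorphic (T U : finType) (G : sgraph T) (H : sgraph U) : Prop :=
  exists2 f : T -> U, bijective f & forall x y, H (f x) (f y) = G x y.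

Section CompleteBipartite.
Variables s t : nat.

Definition bipartite_rel : rel ('I_s + 'I_t)%type := fun x y =>
  match x, y with
  | inl _, inr _ | inr _, inl _ => true
  | _, _ => false
  end.

Fact bipartite_sym : symmetric bipartite_rel.
Proof. by case=> i [] j. Qed.

Fact bipartite_irrefl : irreflexive bipartite_rel.
Proof. by case. Qed.

Definition complete_bipartite : sgraph ('I_s + 'I_t)%type :=
  SGraph bipartite_sym bipartite_irrefl.

Definition first_pair : rel ('I_s + 'I_t)%type := fun x y =>
  match x, y with
  | inl i, inr j => (val i == 0%N) && (val j == 0%N)
  | _, _ => false
  end.

(* The removed edge e joins vertex 0 of one part to vertex 0 of the other, so
   exactly one edge is removed when s and t are positive; all edges of K_{s,t}
   are equivalent under its automorphisms. *)
Definition F : sgraph ('I_s + 'I_t)%type :=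
  complement (remove_edges complete_bipartite first_pair).

End CompleteBipartite.

Section AlphaIndex.
Variables (R : realType) (n : nat).
Implicit Types (G : sgraph 'I_n) (alpha : R).

Definition adjacency_mx G : 'M[R]_n := \matrix_(i, j) (G i j)%:R.

Definition degree_mx G : 'M[R]_n := diag_mx (\row_i (degree G i)%:R).

Definition Aalpha alpha G : 'M[R]_n :=
  alpha *: degree_mx G + (1 - alpha) *: adjacency_mx G.

(* Relational, since a square matrix over R may have no eigenvalue in R;
   Aalpha alpha G is symmetric, so for n > 0 such a value exists, and it is
   always unique. *)
Definition largest_eigenvalue (M : 'M[R]_n) (rho : R) : Prop :=
  eigenvalue M rho /\ forall mu : R, eigenvalue M mu -> mu <= rho.

Definition Aalpha_index alpha G (rho : R) : Prop :=
  largest_eigenvalue (Aalpha alpha G) rho.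

Definition minimizes_Aalpha_index alpha (C : sgraph 'I_n -> Prop) G : Prop :=
  C G /\ exists2 rho : R, Aalpha_index alpha G rho &
    forall (H : sgraph 'I_n) (mu : R),
      C H -> Aalpha_index alpha H mu -> rho <= mu.

End AlphaIndex.

(* Main.v *)
(* Let H be the complement of G; it is triangle-free. The A_alpha-index is the
   maximal Rayleigh quotient, so it is at least the average degree, at least
   k - 1 if G contains K_k, and it strictly increases when edges are added to a
   connected graph. A positive vector w with A_alpha w <= (n/2 - 1/4) w bounds
   the index of F(ceil(n/2), floor(n/2)) by n/2 - 1/4. If H is not bipartite,
   it has at most (n-1)^2/4 + 1 edges, and the average degree of G is at least
   n/2 - 5/(2n), which exceeds n/2 - 1/4 because n >= 11. If H is bipartite, G
   contains two disjoint cliques covering the vertices and an edge between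
   them; an unbalanced pair of cliques makes the index too large, and in the
   balanced case so does any edge beyond those of F. *)

From mathcomp Require functions topology normedtype derive.
Require Import Defs.
From mathcomp Require Import all_boot all_order all_algebra.
From mathcomp Require Import ring lra zify.
From mathcomp Require Import reals.

Set Implicit Arguments.
Unset Strict Implicit.

Import Order.TTheory GRing.Theory Num.Theory.

(** * Triangle-free graphs *)

Section TriangleFree.
Variables (T : finType) (H : sgraph T).

Definition triangle_free : Prop := forall x y z, H x y -> H y z -> ~~ H x z.

Definition bipartition (A : {set T}) : Prop :=
  forall x y, H x y -> (x \in A) != (y \in A).

Local Notation N x := [set y | H x y].
Local Notation d := (degree H).

Lemma degree_sumE x : d x = \sum_y H x y.
Proof.
rewrite /degree -sum1_card big_mkcond; apply: eq_bigr => y _.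
by rewrite inE; case: (H x y).
Qed.

(** Cauchy-Schwarz against the constant function, from [2 * f x * f y <= f x ^ 2 + f y ^ 2] summed
    over all pairs. *)
Lemma sqr_sum_le (f : T -> nat) : (\sum_x f x) ^ 2 <= #|T| * \sum_x f x ^ 2.
Proof.
rewrite -(@leq_pmul2l 2) // -mulnn big_distrlr /= [in leqRHS]mulnCA.
have -> : #|T| * (2 * \sum_x f x ^ 2) = \sum_x \sum_y (f x ^ 2 + f y ^ 2).
  under [RHS]eq_bigr do rewrite big_split /= sum_nat_const.
  by rewrite big_split /= sum_nat_const -big_distrr /= addnn -mul2n mulnCA.
rewrite big_distrr leq_sum //= => x _; rewrite big_distrr leq_sum //= => y _.
exact: nat_Cauchy.
Qed.

(** Summing [d x + d y] over ordered adjacent pairs counts each [d x ^ 2] twice, so twice the sum of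
    squared degrees is at most [c * S]. Cauchy-Schwarz bounds that sum below by [S ^ 2 / #|T|], and
    one factor [S] cancels. *)
Lemma degree_sum_le_of_edges c : (forall x y, H x y -> d x + d y <= c) ->
  2 * \sum_x d x <= #|T| * c.
Proof.
move=> le_c; set S := \sum_x d x; set Q := \sum_x d x ^ 2.
have Q2 : 2 * Q <= c * S.
  have Q1 : \sum_x \sum_y H x y * d x = Q.
    by apply: eq_bigr => x _; rewrite -big_distrl /= -degree_sumE mulnn.
  have -> : 2 * Q = \sum_x \sum_y H x y * (d x + d y).
    under [RHS]eq_bigr do (under eq_bigr do rewrite mulnDr; rewrite big_split /=).
    rewrite big_split /= Q1 exchange_big /= mul2n -addnn -[X in _ + X = _]Q1.
    congr (_ + _); apply: eq_bigr => y _; apply: eq_bigr => x _.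
    by rewrite adj_sym.
  rewrite big_distrr leq_sum //= => x _; rewrite degree_sumE big_distrr.
  apply: leq_sum => y _; have := le_c x y; case: (H x y) => //= le_xy.
  by rewrite mul1n muln1 degree_sumE in le_xy * ; apply: le_xy.
have := sqr_sum_le d; rewrite -/S -/Q; case: (posnP S) => [-> //|S_gt0] CS.
rewrite -(leq_pmul2r S_gt0); nia.
Qed.

(* Triangle-freeness: a neighbour of z in A is adjacent to no neighbour of z. *)
Lemma degree_sum_side (A B : {set T}) z : triangle_free -> z \notin B ->
  (forall a, a \in A -> N a \subset z |: B) ->
  \sum_(a in A) d a + #|N z :&: A| * #|N z :&: B| <= #|A| * #|B| + #|N z :&: A|.
Proof.
move=> tf zB NA.
have sumI (f : nat) :
    #|N z :&: A| * f = \sum_(a in A) (a \in [set y | H z y]) * f.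
  rewrite -sum_nat_const [RHS](big_setID (N z)) /= setIC [X in _ = _ + X]big1 ?addn0.
    by apply: eq_bigr => a; rewrite in_setI => /andP[_ ->]; rewrite mul1n.
  by move=> a; rewrite !inE => /andP[/negPf->]; rewrite mul0n.
rewrite sumI -[#|A| * #|B|]sum_nat_const -[X in _ <= _ + X]muln1 sumI.
rewrite -!big_split leq_sum //= => a aA.
have NaB := NA a aA; rewrite muln1; have [za|nza] := boolP (a \in [set y | H z y]).
  (* For [a] adjacent to [z], the neighbours of [a] other than [z] lie in [B] and avoid [N z], which
     gives [d a + #|N z :&: B| <= #|B| + 1]. For the other [a], treated below, [N a] lies in [B]. *)
  rewrite mul1n addnC -leq_subRL; last first.
    by apply: leq_trans (subset_leq_card (subsetIr _ _)) (leq_addr _ _).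
  have -> : #|B| + 1 - #|N z :&: B| = #|z |: (B :\: N z)|.
    rewrite cardsU1 !inE (negPf zB) andbF /= addnC.
    rewrite -addnBA ?subset_leq_card ?subsetIr //.
    by rewrite setIC cardsD.
  apply: subset_leq_card; apply/subsetP => b ab.
  have := subsetP NaB b ab; rewrite !inE => /predU1P[->|->]; rewrite ?eqxx //.
  rewrite andbT; apply/orP; right; apply: tf; last by rewrite inE in ab; exact: ab.
  by rewrite inE in za.
rewrite mul0n addn0 addn0; apply: subset_leq_card; apply/subsetP => b ab.
have := subsetP NaB b ab; rewrite !inE => /predU1P[bz|//].
by move: ab nza; rewrite !inE bz adj_sym => ->.
Qed.

(** If every edge has degree sum at most [#|T| - 2], the edge bound suffices. Otherwise the
    neighbourhoods of the ends of some edge are independent, disjoint and miss at most one vertex,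
    so the graph is bipartite or that vertex costs many edges between the two sides. *)
Lemma triangle_free_dichotomy : triangle_free ->
  (exists A, bipartition A) \/ 2 * \sum_x d x <= (#|T| - 1) ^ 2 + 4.
Proof.
move=> tf.
have [/existsP[x /existsP[y /andP[xy dxy]]]|small] :=
  boolP [exists x, [exists y, H x y && (#|T| <= d x + d y + 1)]]; last first.
  right; apply: leq_trans (@degree_sum_le_of_edges (#|T| - 2) _) _; last by nia.
  move=> x y xy; move: small; rewrite negb_exists => /forallP /(_ x).
  by rewrite negb_exists => /forallP /(_ y); rewrite xy /=; lia.
(* A and B are disjoint independent sets missing at most one vertex z. If z has
   neighbours in both, then the a' * b' pairs of these neighbours are non-edges. *)
set A := N x; set B := N y.
have indN z a b : H z a -> H z b -> ~~ H a b by move=> za; apply: contraL; apply: tf.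
have dAB : [disjoint A & B].
  by rewrite -setI_eq0; apply/eqP/setP => z; rewrite !inE; apply/negP => /andP[xz];
    apply/negP; rewrite adj_sym in xy; apply: (tf _ _ _ xy).
have cardAB : #|A :|: B| = #|A| + #|B|.
  by rewrite cardsU disjoint_setI0 // cards0 subn0.
have indA a b : a \in A -> b \in A -> ~~ H a b by rewrite !inE; exact: indN.
have indB a b : a \in B -> b \in B -> ~~ H a b by rewrite !inE; exact: indN.
have [z zAB|cover] := pickP [pred z | z \notin A :|: B]; last first.
  left; exists A => a b ab; have inAB c : (c \in A) || (c \in B).
    by have /negbFE := cover c; rewrite inE.
  move: (inAB a) (inAB b) (indA a b) (indB a b); rewrite ab /=.
  case: (a \in A); case: (b \in A) => //= aB bB h1 h2; first by have := h1 isT isT.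
  by have := h2 aB bB.
have zN : #|A| + #|B| + 1 = #|T| /\ forall c, c \notin A :|: B -> c = z.
  have cardC : #|A :|: B| + #|~: (A :|: B)| = #|T| := cardsC _.
  have zC : z \in ~: (A :|: B) by rewrite in_setC.
  have : 0 < #|~: (A :|: B)| by apply/card_gt0P; exists z.
  rewrite /degree -/A -/B -cardAB -cardC in dxy * => C_gt0.
  have C1 : #|~: (A :|: B)| = 1 by lia.
  split=> [|c cAB]; first by rewrite C1.
  have /eqP/cards1P[z' Cz'] := C1; have : c \in ~: (A :|: B) by rewrite in_setC.
  by move: zC; rewrite Cz' !inE => /eqP-> /eqP.
have {zN dxy} [cardT zN] := zN.
have [zA zB] : z \notin A /\ z \notin B by apply/norP; rewrite -in_setU.
have sideA a : a \in A -> N a \subset z |: B.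
  move=> aA; apply/subsetP => b; rewrite in_set in_setU1 => ab.
  have [//|bz] := eqVneq b z; have : b \in A :|: B.
    by apply: contraNT bz => /zN->.
  by rewrite in_setU => /orP[bA|//]; have := indA a b aA bA; rewrite ab.
have sideB b : b \in B -> N b \subset z |: A.
  move=> bB; apply/subsetP => a; rewrite in_set in_setU1 => ba.
  have [//|az] := eqVneq a z; have : a \in A :|: B.
    by apply: contraNT az => /zN->.
  by rewrite in_setU => /orP[//|aB]; have := indB b a bB aB; rewrite ba.
have inABz c : [\/ c \in A, c \in B | c = z].
  have [cA|cA] := boolP (c \in A); first by constructor 1.
  have [cB|cB] := boolP (c \in B); first by constructor 2.
  by constructor 3; apply: zN; rewrite in_setU negb_or cA.
(* If [z] has no neighbour in [P], it can be added to [P], and [Q] becomes one side of a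
   bipartition. *)
have bip (P Q : {set T}) : (forall a b, a \in P -> b \in P -> ~~ H a b) ->
    (forall a b, a \in Q -> b \in Q -> ~~ H a b) -> N z :&: P = set0 ->
    (forall c, c \notin Q -> c \in P \/ c = z) -> bipartition Q.
  move=> indP indQ /setP zP outQ a b ab.
  have nzP c : c \in P -> ~~ H z c.
    by move=> cP; have := zP c; rewrite !inE cP andbT => ->.
  have [aQ|/outQ aP] := boolP (a \in Q);
    have [bQ|/outQ bP] := boolP (b \in Q) => //.
    by have := indQ a b aQ bQ; rewrite ab.
  move: ab; case: aP => [aP|->]; case: bP => [bP|->].
  - by rewrite (negPf (indP a b aP bP)).
  - by rewrite adj_sym (negPf (nzP a aP)).
  - by rewrite (negPf (nzP b bP)).
  - by rewrite adj_irrefl.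
have [A0|A_gt0] := eqVneq (N z :&: A) set0.
  left; exists B; apply: (bip A) => // c cB.
  by case: (inABz c) => [|cB'|]; [left | rewrite cB' in cB | right].
have [B0|B_gt0] := eqVneq (N z :&: B) set0.
  left; exists A; apply: (bip B) => // c cA.
  by case: (inABz c) => [cA'||]; [rewrite cA' in cA | left | right].
right; have SA := degree_sum_side tf zB sideA; have SB := degree_sum_side tf zA sideB.
have dz : d z <= #|N z :&: A| + #|N z :&: B|.
  rewrite /degree; apply: leq_trans (leq_card_setU _ _).
  apply: subset_leq_card; apply/subsetP => c zc.
  rewrite -setIUr in_setI zc in_setU; have [->|->|cz] // := inABz c.
    by rewrite orbT.
  by move: zc; rewrite inE cz adj_irrefl.
have -> : \sum_c d c = \sum_(a in A) d a + \sum_(b in B) d b + d z.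
  rewrite (bigID (mem (A :|: B))) /= (eq_bigl [predU A & B]) ?bigU //; last first.
    by move=> c; rewrite !inE.
  congr (_ + _); apply: big_pred1 => c.
  by apply/idP/eqP => [/zN//|->]; exact: zAB.
rewrite -cardT addnK; move: A_gt0 B_gt0; rewrite -!card_gt0.
move: SA SB dz.
move: #|N z :&: A| #|N z :&: B| #|A| #|B| => a' b' a b.
move: (\sum_(a in A) d a) (\sum_(b in B) d b) (d z) => s1 s2 s3.
move=> SA SB dz a'_gt0 b'_gt0.
(* This is [(a' - 1) * (b' - 1) >= 0], valid because [z] has neighbours on both sides. With [SA],
   [SB] and [dz] it bounds the degree sum by [2 * a * b + 2], and [4 * a * b <= (a + b) ^ 2]. *)
have h1 : a' + b' <= a' * b' + 1 by nia.
have [h2 _] := nat_AGM2 a b.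
rewrite (mulnC b a) (mulnC b' a') in SB.
move: (a' * b') (a * b) ((a + b) ^ 2) h1 h2 SA SB => u v w; lia.
Qed.

End TriangleFree.

(** * Two cliques joined by an edge *)

Section TwoCliques.
Variables (T : finType) (A : {set T}) (u v : T).

(* With u in A and v outside A, this is F(#|A|, #|~: A|) with uv as the joining
   edge, on the vertex set T itself. *)
Definition two_cliques_rel : rel T := fun x y =>
  (x != y) && [|| (x \in A) == (y \in A),
    (x == u) && (y == v) | (x == v) && (y == u)].

Lemma two_cliques_sym : symmetric two_cliques_rel.
Proof.
move=> x y; rewrite /two_cliques_rel eq_sym (eq_sym (x \in A)).
by case: (x == u); case: (x == v); case: (y == u); case: (y == v); rewrite ?orbT.
Qed.

Lemma two_cliques_irrefl : irreflexive two_cliques_rel.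
Proof. by move=> x; rewrite /two_cliques_rel eqxx. Qed.

Definition two_cliques : sgraph T := SGraph two_cliques_sym two_cliques_irrefl.

Hypotheses (uA : u \in A) (vA : v \notin A).

Lemma connected_two_cliques : connected two_cliques.
Proof.
have conn x : connect two_cliques u x.
  have same a y : (a \in A) = (y \in A) -> connect two_cliques a y.
    move=> ay; have [->|ne] := eqVneq a y; first exact: connect0.
    by apply: connect1; rewrite /= /two_cliques_rel ne ay eqxx.
  have [xA|xA] := boolP (x \in A); first by apply: same; rewrite uA xA.
  apply: (@connect_trans _ _ v); last by apply: same; rewrite (negPf vA) (negPf xA).
  apply: connect1; rewrite /= /two_cliques_rel !eqxx /= orbT andbT.
  by apply: contraTneq uA => ->.
move=> x y; apply: connect_trans (conn y).
by rewrite (sym_connect_sym (adj_sym two_cliques)).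
Qed.

(** A stable set meets each clique at most once. A vertex of [A] other than [u] is not adjacent to
    [v], which gives a stable pair. *)
Lemma independence_number_two_cliques : 1 < #|A| ->
  independence_number two_cliques = 2.
Proof.
move=> A2; apply/eqP; rewrite eqn_leq; apply/andP; split.
  apply/bigmax_leqP => S /forall_inP stS.
  have le1 (B : {set T}) : {in B &, forall x y, x != y -> two_cliques x y} ->
      #|S :&: B| <= 1.
    move=> cB; apply/card_le1P => x; rewrite inE => /andP[xS xB] y.
    rewrite !inE; apply/andP/eqP => [[yS yB]|-> //].
    apply: contraTeq (forall_inP (stS y yS) x xS) => yx; rewrite negbK.
    exact: cB.
  rewrite -(cardsID A S); apply: (leq_add (n1 := 1) (n2 := 1)).
    by apply: le1 => x y xA yA xy; rewrite /= /two_cliques_rel xy xA yA.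
  rewrite setDE; apply: le1 => x y; rewrite !inE => /negPf xA /negPf yA xy.
  by rewrite /= /two_cliques_rel xy xA yA.
have [a aA au] : exists2 a, a \in A & a != u.
  have : 0 < #|A :\ u| by move: A2; rewrite (cardsD1 u) uA.
  by case/card_gt0P => a; rewrite !inE => /andP[]; exists a.
have av : a != v by apply: contraTneq aA => ->.
have <- : #|[set a; v]| = 2 by rewrite cards2 av.
apply: leq_bigmax_cond; apply/forall_inP => x xS; apply/forall_inP => y yS.
move: xS yS; rewrite !inE /= /two_cliques_rel => /orP[]/eqP-> /orP[]/eqP->;
  by rewrite ?eqxx ?(eq_sym v a) ?aA ?(negPf vA) ?(negPf au) ?(negPf av) ?andbF.
Qed.

Lemma isomorphic_two_cliques : isomorphic two_cliques (F #|A| #|~: A|).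
Proof.
(* The enumerations start with [u] and [v], so that these get index 0, the ends of the edge that
   [first_pair] removes from the bipartite graph. *)
pose sA := u :: enum (A :\ u); pose sB := v :: enum (~: A :\ v).
have mem_sA : sA =i A.
  by move=> x; rewrite inE mem_enum !inE; case: eqVneq => //= ->.
have mem_sB x : (x \in sB) = (x \notin A).
  by rewrite inE mem_enum !inE; case: eqVneq => //= ->.
have uniq_sA : uniq sA by rewrite /= enum_uniq mem_enum !inE eqxx.
have uniq_sB : uniq sB by rewrite /= enum_uniq mem_enum !inE eqxx.
have size_sA : size sA = #|A| by rewrite -(card_uniqP uniq_sA); apply: eq_card.
have size_sB : size sB = #|~: A|.
  by rewrite -(card_uniqP uniq_sB); apply: eq_card => x; rewrite mem_sB inE.
pose g (i : 'I_#|A| + 'I_#|~: A|) : T :=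
  match i with inl i => nth u sA i | inr j => nth v sB j end.
have gA i : g (inl i) \in A by rewrite -mem_sA mem_nth // size_sA.
have gB j : g (inr j) \notin A by rewrite -mem_sB mem_nth // size_sB.
have g_inj : injective g.
  move=> [i|i] [j|j] gij.
  - congr inl; apply: val_inj; apply/eqP.
    by move/eqP: gij; rewrite /g nth_uniq ?size_sA.
  - by have := gB j; rewrite -gij gA.
  - by have := gB i; rewrite gij gA.
  - congr inr; apply: val_inj; apply/eqP.
    by move/eqP: gij; rewrite /g nth_uniq ?size_sB.
have [f fK gK] : bijective g.
  by apply: inj_card_bij => //; rewrite card_sum !card_ord cardsC.
exists f; first by exists g.
have gu i : (g (inl i) == u) = (val i == 0).
  rewrite /g -[X in _ == X]/(nth u sA 0) nth_uniq ?size_sA //.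
  exact: leq_ltn_trans (ltn_ord i).
have gv j : (g (inr j) == v) = (val j == 0).
  rewrite /g -[X in _ == X]/(nth v sB 0) nth_uniq ?size_sB //.
  exact: leq_ltn_trans (ltn_ord j).
have gu' j : (g (inr j) == u) = false by apply: contraNF (gB j) => /eqP->.
have gv' i : (g (inl i) == v) = false.
  by apply: contraTF (gA i) => /eqP->.
suff FE p q : F #|A| #|~: A| p q = two_cliques (g p) (g q).
  by move=> x y; rewrite FE !gK.
rewrite /= /two_cliques_rel (inj_eq g_inj); congr (_ && _).
case: p q => [i|i] [j|j]; rewrite ?gu ?gv ?gu' ?gv' ?gA ?(negPf (gB _)) //=.
- by rewrite orbF; case: (_ && _).
- by rewrite andbC; case: (_ && _).
Qed.

End TwoCliques.

Local Open Scope ring_scope.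

(** * Rayleigh quotients and the largest eigenvalue *)

Section Rayleigh.
Variables (R : realType) (n : nat).
Implicit Types (x y : 'rV[R]_n) (M : 'M[R]_n).

Definition dotv x y : R := \sum_i x 0 i * y 0 i.

Lemma dotvC x y : dotv x y = dotv y x.
Proof. by apply: eq_bigr => i _; rewrite mulrC. Qed.

Lemma dotvDl x y z : dotv (x + y) z = dotv x z + dotv y z.
Proof. by rewrite -big_split; apply: eq_bigr => i _; rewrite mxE mulrDl. Qed.

Lemma dotvZl a x y : dotv (a *: x) y = a * dotv x y.
Proof. by rewrite mulr_sumr; apply: eq_bigr => i _; rewrite mxE mulrA. Qed.

Lemma dotv_mulmx M x y : M^T = M -> dotv (x *m M) y = dotv x (y *m M).
Proof.
move=> sM; have dE a b : dotv a b = (a *m b^T) 0 0.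
  by rewrite mxE; apply: eq_bigr => i _; rewrite mxE.
by rewrite !dE trmx_mul sM mulmxA.
Qed.

Lemma dotv_ge0 x : 0 <= dotv x x.
Proof. by apply: sumr_ge0 => i _; rewrite -expr2 sqr_ge0. Qed.

Lemma dotv_eq0 x : dotv x x = 0 -> x = 0.
Proof.
move=> /eqP; rewrite psumr_eq0 => [/allP x0|i _]; last by rewrite -expr2 sqr_ge0.
apply/rowP => i; rewrite mxE; apply/eqP.
by have /= := x0 i (mem_index_enum i); rewrite mulf_eq0 orbb.
Qed.

Lemma dotv_gt0 x : x != 0 -> 0 < dotv x x.
Proof.
by rewrite lt_def dotv_ge0 andbT; apply: contra_neq => /dotv_eq0.
Qed.

(** A zero of a nonnegative quadratic form is a minimum, so the gradient vanishes there. This turns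
    maximizers of the Rayleigh quotient into eigenvectors. *)
Lemma psd_null_vector M x : M^T = M -> (forall y, 0 <= dotv (y *m M) y) ->
  dotv (x *m M) x = 0 -> x *m M = 0.
Proof.
move=> sM psd x0; apply: dotv_eq0; set y := x *m M.
have q_ge0 := psd y; set q := dotv (y *m M) y in q_ge0.
have p_ge0 := dotv_ge0 y; set p := dotv y y in p_ge0 *.
have q1_gt0 : 0 < q + 1 by rewrite ltr_wpDl.
(* Since x is isotropic, the value of the form at (q + 1) x - p y is
   - p ^ 2 (q + 2), which forces p = 0. *)
have := psd ((q + 1) *: x + (- p) *: y).
rewrite mulmxDl -!scalemxAl -/y !(dotvDl, dotvZl).
rewrite !(dotvC _ (_ + _)) !(dotvDl, dotvZl).
rewrite (dotvC x y) x0 -/p (dotvC y) -/q (dotvC x) dotv_mulmx // -/y -/p => h.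
by apply/eqP; rewrite eq_le p_ge0 andbT; nra.
Qed.

Section Compactness.
Import boolp classical_sets functions set_interval topology normedtype derive.
Import numFieldNormedType.Exports.

Lemma continuous_sum (T : topologicalType) (f : 'I_n -> T -> R) :
  (forall i, continuous (f i)) -> continuous (fun t => \sum_i f i t).
Proof.
move=> cf t; pose P (g : T -> R) := {for t, continuous g}.
have -> : (fun t => \sum_i f i t) = \sum_i f i.
  by apply: funext => u; rewrite fct_sumE.
apply: (@big_ind _ P); [exact: cst_continuous | | by move=> i _; exact: cf].
by move=> g h; exact: continuousD.
Qed.

(** The unit sphere is a closed subset of the compact cube with side [-1, 1], and it is nonempty
    when [n > 0], so the continuous form attains its maximum on it. *)
Lemma rayleigh_max_attained M : (0 < n)%N ->
  exists2 x, dotv x x = 1 & forall y, dotv y y = 1 ->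
    dotv (y *m M) y <= dotv (x *m M) x.
Proof.
move=> n_gt0.
have cdot (f g : 'rV[R]_n -> 'rV[R]_n) : (forall i, continuous (fun x => f x 0 i)) ->
    (forall i, continuous (fun x => g x 0 i)) ->
    continuous (fun x => dotv (f x) (g x)).
  move=> cf cg.
  by apply: continuous_sum => i x; apply: continuousM; [exact: cf|exact: cg].
have cid i : continuous (fun x : 'rV[R]_n => x 0 i) by exact: coord_continuous.
have cM i : continuous (fun x : 'rV[R]_n => (x *m M) 0 i).
  have -> : (fun x => (x *m M) 0 i) = (fun x : 'rV[R]_n => \sum_j x 0 j * M j i).
    by apply: funext => x; rewrite mxE.
  apply: continuous_sum => j x.
  by apply: continuousM; [exact: cid | exact: cst_continuous].
pose S := [set x : 'rV[R]_n | dotv x x = 1]%classic.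
have Scl : closed S.
  apply: (@preimage_closed _ _ (fun x => dotv x x) [set 1 : R]%classic).
    by move=> x _; exact: cdot.
  exact: closed_eq.
have Scp : compact S.
  apply: (@subclosed_compact _ S
    [set v : 'rV[R]_n | forall i, (`[- 1, 1] : set R) (v ord0 i)]%classic) => //.
    have := @rV_compact R n (fun=> `[- 1, 1]%classic).
    by apply=> _; exact: segment_compact.
  move=> x /= x1 i; rewrite in_itv /= -ler_norml -(ler_pXn2r (n := 2)) ?nnegrE //.
  rewrite expr1n -normrX ger0_norm ?sqr_ge0 // -[leRHS]x1 /dotv (bigD1 i) //= expr2.
  by rewrite lerDl sumr_ge0 // => j _; rewrite -expr2 sqr_ge0.
have S0 : (S !=set0)%classic.
  exists (delta_mx 0 (Ordinal n_gt0)); rewrite /S /= /dotv.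
  by rewrite (bigD1 (Ordinal n_gt0)) //= big1 => [|i /negPf ni];
    rewrite !mxE ?eqxx ?ni ?mulr0 // mul1r addr0.
have [|x Sx xmax] := compact_EVT_max (f := fun x => dotv (x *m M) x) S0 Scp.
  exact/continuous_subspaceT/cdot.
exists x => [|y y1]; first by rewrite inE in Sx.
by apply: xmax; rewrite inE.
Qed.

End Compactness.

Lemma dotv0l y : dotv 0 y = 0.
Proof. by rewrite /dotv big1 // => i _; rewrite mxE mul0r. Qed.

Lemma dotv_eigen M a x : x *m M = a *: x -> dotv (x *m M) x = a * dotv x x.
Proof. by move=> ->; rewrite dotvZl. Qed.

(** The form of [rho%:M - M] is nonnegative and vanishes at [x], so [x] is in its kernel. *)
Lemma rayleigh_eq_eigen M rho x : M^T = M ->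
  (forall y, dotv (y *m M) y <= rho * dotv y y) ->
  dotv (x *m M) x = rho * dotv x x -> x *m M = rho *: x.
Proof.
move=> sM le_rho eq_rho; pose N := rho%:M - M.
have NE y : dotv (y *m N) y = rho * dotv y y - dotv (y *m M) y.
  rewrite mulmxBr mul_mx_scalar -scaleN1r dotvDl !dotvZl.
  by rewrite mulN1r.
have := @psd_null_vector N x; rewrite NE eq_rho subrr mulmxBr mul_mx_scalar.
move=> N0; apply/esym/eqP; rewrite -subr_eq0; apply/eqP/N0 => //.
  by rewrite /N linearB /= tr_scalar_mx sM.
by move=> y; rewrite NE subr_ge0.
Qed.

(** The maximum of the form on the unit sphere bounds all Rayleigh quotients by homogeneity. It is
    an eigenvalue at the maximizer, and any other eigenvalue is itself a Rayleigh quotient. *)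
Lemma largest_eigenvalue_exists M : (0 < n)%N -> M^T = M ->
  exists2 rho, largest_eigenvalue M rho &
    forall y, dotv (y *m M) y <= rho * dotv y y.
Proof.
move=> n_gt0 sM; have [x x1 xmax] := rayleigh_max_attained M n_gt0.
pose rho := dotv (x *m M) x.
have le_rho y : dotv (y *m M) y <= rho * dotv y y.
  have [->|y0] := eqVneq y 0; first by rewrite mul0mx !dotv0l mulr0.
  have y2_gt0 := dotv_gt0 y0.
  pose c := (Num.sqrt (dotv y y))^-1.
  have c2 : c * c = (dotv y y)^-1 by rewrite -expr2 exprVn sqr_sqrtr ?ltW.
  have := xmax (c *: y); rewrite -scalemxAl !dotvZl !(dotvC _ (_ *: _)) !dotvZl.
  rewrite !mulrA c2 mulVf ?gt_eqF // => /(_ erefl).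
  by rewrite ler_pdivrMl // mulrC (dotvC y).
exists rho => //; split.
  apply/eigenvalueP; exists x; last first.
    by apply: contra_eq_neq x1 => ->; rewrite dotv0l eq_sym oner_eq0.
  by apply: rayleigh_eq_eigen => //; rewrite x1 mulr1.
move=> mu /eigenvalueP[v vM v0].
by have := le_rho v; rewrite (dotv_eigen vM) ler_pM2r // dotv_gt0.
Qed.

Lemma rayleigh_le M rho y : M^T = M -> largest_eigenvalue M rho ->
  dotv (y *m M) y <= rho * dotv y y.
Proof.
move=> sM [rhoM rho_max]; case: (posnP n) => [n0|n_gt0].
  by rewrite /dotv !big1 ?mulr0 // => i; have := ltn_ord i; lia.
have [rho' [rho'M rho'_max] le_rho'] := largest_eigenvalue_exists n_gt0 sM.
suff -> : rho = rho' by [].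
by apply/eqP; rewrite eq_le rho'_max // rho_max.
Qed.

(** The weak Perron-Frobenius theorem: replacing an eigenvector by its entrywise absolute value
    keeps the norm and the diagonal terms and does not decrease the others, so the maximal quotient
    is attained again. *)
Lemma nonneg_eigenvector M rho : M^T = M -> (forall i j, i != j -> 0 <= M i j) ->
  largest_eigenvalue M rho ->
  exists2 x : 'rV_n, x != 0 & (forall i, 0 <= x 0 i) /\ x *m M = rho *: x.
Proof.
move=> sM M_ge0 Mrho; have [/eigenvalueP[v vM v0] _] := Mrho.
pose x : 'rV[R]_n := \row_i `|v 0 i|; exists x.
  apply: contra_neq v0 => x0; apply/rowP => i; rewrite mxE.
  by move/rowP: x0 => /(_ i)/eqP; rewrite !mxE normr_eq0 => /eqP.
split=> [i|]; first by rewrite mxE.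
apply: rayleigh_eq_eigen => // [y|]; first exact: rayleigh_le.
apply/eqP; rewrite eq_le rayleigh_le //=.
have -> : dotv x x = dotv v v.
  by apply: eq_bigr => i _; rewrite !mxE -!expr2 real_normK ?num_real.
rewrite -(dotv_eigen vM); apply: ler_sum => i _.
rewrite !mxE !mulr_suml; apply: ler_sum => j _; rewrite !mxE.
have [->|ji] := eqVneq j i.
  by rewrite mulrAC [leRHS]mulrAC -!expr2 real_normK ?num_real.
rewrite mulrAC [leRHS]mulrAC -normrM ler_wpM2r ?M_ge0 ?ler_norm //.
Qed.

(** The Collatz-Wielandt bound. For a nonnegative eigenvector [x], symmetry moves [M] from [x] to
    [w] in [dotv], so [rho * dotv x w <= lam * dotv x w], and [dotv x w] is positive. *)
Lemma largest_eigenvalue_le_weight M (rho lam : R) (w : 'rV_n) : M^T = M ->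
  (forall i j, i != j -> 0 <= M i j) -> largest_eigenvalue M rho ->
  (forall i, 0 < w 0 i) -> (forall i, (w *m M) 0 i <= lam * w 0 i) ->
  rho <= lam.
Proof.
move=> sM M_ge0 Mrho w_gt0 le_lam.
have [x x0 [x_ge0 xM]] := nonneg_eigenvector sM M_ge0 Mrho.
have [k xk] : exists k, x 0 k != 0.
  apply/existsP; rewrite -negb_forall; apply: contra x0 => /forallP x0.
  by apply/eqP/rowP => i; rewrite mxE; apply/eqP.
have xw_gt0 : 0 < dotv x w.
  rewrite /dotv (bigD1 k) //= ltr_pwDl ?mulr_gt0 //.
    by rewrite lt_def xk x_ge0.
  by apply: sumr_ge0 => i _; rewrite mulr_ge0 // ltW.
rewrite -(ler_pM2r xw_gt0) -dotvZl -xM dotv_mulmx // (dotvC x w) -dotvZl [leLHS]dotvC.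
apply: ler_sum => i _; apply: ler_wpM2r => //.
by apply: le_trans (le_lam i) _; rewrite mxE.
Qed.

End Rayleigh.

(** * The A_alpha-index *)

Section AlphaMatrix.
Variables (R : realType) (n : nat) (alpha : R).
Implicit Types (x : 'rV[R]_n) (G H : sgraph 'I_n).

Lemma natr_degree G i : (degree G i)%:R = \sum_j (G i j)%:R :> R.
Proof.
rewrite /degree -sum1_card natr_sum big_mkcond; apply: eq_bigr => j _.
by rewrite inE; case: (G i j).
Qed.

Lemma tr_Aalpha G : (Aalpha alpha G)^T = Aalpha alpha G.
Proof.
apply/matrixP => i j; rewrite !mxE adj_sym eq_sym.
by case: eqP => [->|]; rewrite ?mulr0n.
Qed.

Lemma Aalpha_offdiag_ge0 G i j : alpha <= 1 -> i != j -> 0 <= Aalpha alpha G i j.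
Proof.
move=> a1 /negPf ij; rewrite !mxE ij mulr0n mulr0 add0r.
by rewrite mulr_ge0 ?subr_ge0.
Qed.

Lemma mulmx_Aalpha G x i : (x *m Aalpha alpha G) 0 i =
  \sum_j (G i j)%:R * (alpha * x 0 i + (1 - alpha) * x 0 j).
Proof.
rewrite mulmxDr -!scalemxAr mul_mx_diag !mxE natr_degree !mulr_sumr -big_split.
by apply: eq_bigr => j _ /=; rewrite !mxE adj_sym; ring.
Qed.

Lemma Aalpha_form G x : dotv (x *m Aalpha alpha G) x =
  \sum_i \sum_j (G i j)%:R * (alpha * x 0 i + (1 - alpha) * x 0 j) * x 0 i.
Proof. by apply: eq_bigr => i _; rewrite mulmx_Aalpha mulr_suml. Qed.

(** The test vector is all ones: row [i] of [Aalpha alpha G] sums to the degree of [i]. *)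
Lemma sum_degree_le_index G rho : Aalpha_index alpha G rho ->
  (\sum_i degree G i)%:R <= rho * n%:R.
Proof.
move=> Grho; have := rayleigh_le (const_mx 1 : 'rV_n) (tr_Aalpha G) Grho.
pose one : 'rV[R]_n := const_mx 1; have -> : dotv one one = n%:R.
  rewrite /dotv (eq_bigr (fun=> 1)) => [|i _]; last by rewrite !mxE mulr1.
  by rewrite sumr_const card_ord.
rewrite Aalpha_form natr_sum; congr (_ <= _); apply: eq_bigr => i _.
by rewrite natr_degree; apply: eq_bigr => j _; rewrite !mxE; ring.
Qed.

(** The test vector is the indicator of [A], at which each row of the clique contributes at least
    [#|A| - 1]. *)
Lemma clique_le_index G rho (A : {set 'I_n}) : 0 <= alpha <= 1 ->
  Aalpha_index alpha G rho -> A != set0 ->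
  {in A &, forall i j, i != j -> G i j} -> #|A|%:R <= rho + 1.
Proof.
move=> /andP[a0 a1] Grho A0 cliqueA.
pose x : 'rV[R]_n := \row_i (i \in A)%:R.
have sumA : \sum_i (i \in A)%:R = #|A|%:R :> R.
  rewrite -sum1_card natr_sum [RHS]big_mkcond /=; apply: eq_bigr => i _.
  by case: (i \in A).
have xx : dotv x x = #|A|%:R.
  rewrite -sumA; apply: eq_bigr => i _.
  by rewrite !mxE -natrM mulnb andbb.
have A_gt0 : 0 < #|A|%:R :> R by rewrite ltr0n card_gt0.
have := rayleigh_le x (tr_Aalpha G) Grho; rewrite xx => le_rho.
rewrite -(ler_pM2r A_gt0) mulrDl mul1r; apply: le_trans (lerD le_rho (lexx _)).
rewrite Aalpha_form -sumA mulr_suml -big_split; apply: ler_sum => i _.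
rewrite sumA /= !mxE; have [iA|_] := boolP (i \in A); last first.
  by rewrite mul0r addr0; apply: sumr_ge0 => j _; rewrite mulr0.
(* The term [j = i] of the expanded [#|A|] cancels against the 1 of [rho + 1]; on the right that
   term is 0 for lack of loops. *)
rewrite mul1r -sumA (bigD1 i) //= iA addrC lerD2r [leRHS](bigD1 i) //=.
rewrite adj_irrefl !mul0r add0r; apply: ler_sum => j ji.
rewrite !mxE !mulr1; have [jA|_] := boolP (j \in A).
  by rewrite cliqueA // 1?eq_sym //= mulr1n; lra.
by rewrite mulr0 addr0 mulr_ge0.
Qed.

(** The zero set of [x] is closed under adjacency: at a zero, the eigenvalue equation makes a sum of
    nonnegative terms vanish, and [1 - alpha > 0] passes the zero on to each neighbour. By
    connectivity one zero would force [x = 0]. *)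
Lemma connected_eigenvector_gt0 G rho x : alpha < 1 -> connected G ->
  x != 0 -> (forall i, 0 <= x 0 i) -> 0 <= alpha ->
  x *m Aalpha alpha G = rho *: x -> forall i, 0 < x 0 i.
Proof.
move=> a1 conG x0 x_ge0 a0 xG i; rewrite lt_def x_ge0 andbT.
apply: contra x0 => /eqP xi0; apply/eqP/rowP => k; rewrite mxE.
suff : closed G [pred j | x 0 j == 0].
  by move/closed_connect => /(_ _ _ (conG i k)); rewrite !inE xi0 eqxx => /esym/eqP.
apply: intro_closed => [|j l Gjl]; first exact/sym_connect_sym/adj_sym.
rewrite !inE => /eqP xj0; move/rowP: xG => /(_ j).
rewrite mulmx_Aalpha [RHS]mxE xj0 !mulr0 => /eqP.
rewrite psumr_eq0 => [/allP /(_ l (mem_index_enum l)) /=|m _]; last first.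
  by rewrite add0r !mulr_ge0 // subr_ge0 ltW.
by rewrite Gjl add0r mul1r mulf_eq0 subr_eq0 (gt_eqF a1).
Qed.

(** The form of [G] at the positive eigenvector of [H] dominates that of [H] term by term, strictly
    at the edge [p q]. *)
Lemma index_lt_subgraph G H rhoG rhoH p q : 0 <= alpha < 1 -> connected H ->
  subrel H G -> G p q -> ~~ H p q ->
  Aalpha_index alpha H rhoH -> Aalpha_index alpha G rhoG -> rhoH < rhoG.
Proof.
move=> /andP[a0 a1] conH HG Gpq nHpq Hrho Grho.
have [|x x0 [x_ge0 xH]] := nonneg_eigenvector (tr_Aalpha H) _ Hrho.
  by move=> i j; apply: Aalpha_offdiag_ge0; apply: ltW.
have x_gt0 := connected_eigenvector_gt0 a1 conH x0 x_ge0 a0 xH.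
rewrite -(ltr_pM2r (dotv_gt0 x0)) -(dotv_eigen xH).
apply: lt_le_trans (rayleigh_le x (tr_Aalpha G) Grho).
have term_ge0 i j : 0 <= (alpha * x 0 i + (1 - alpha) * x 0 j) * x 0 i.
  by rewrite mulr_ge0 // addr_ge0 // mulr_ge0 // subr_ge0 ltW.
have le_term i j : (H i j)%:R * (alpha * x 0 i + (1 - alpha) * x 0 j) * x 0 i
   <= (G i j)%:R * (alpha * x 0 i + (1 - alpha) * x 0 j) * x 0 i.
  rewrite -!mulrA ler_wpM2r // ler_nat.
  by have := HG i j; case: (H i j) => // ->.
rewrite !Aalpha_form (bigD1 p) //= [ltRHS](bigD1 p) //= ltr_leD //; last first.
  by apply: ler_sum => i _; apply: ler_sum => j _.
rewrite (bigD1 q) //= [ltRHS](bigD1 q) //= ltr_leD //; last first.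
  by apply: ler_sum => j _.
rewrite Gpq (negPf nHpq) !mul0r mul1r mulr_gt0 //.
by rewrite ltr_wpDl ?mulr_ge0 // mulr_gt0 // subr_gt0.
Qed.

End AlphaMatrix.

(** * The index of two joined cliques *)

Lemma two_cliquesC (T : finType) (A : {set T}) u v :
  two_cliques (~: A) v u =2 two_cliques A u v.
Proof.
move=> x y; rewrite /= /two_cliques_rel !in_setC (inj_eq negb_inj).
by congr (_ && (_ || _)); rewrite orbC.
Qed.

Section TwoCliquesIndex.
Variables (R : realType) (n : nat) (alpha : R).
Implicit Types (A : {set 'I_n}) (u v : 'I_n).

Lemma sum_two_cliques A u v i (f : 'I_n -> R) : u \in A -> v \notin A -> i \in A ->
  \sum_j (two_cliques A u v i j)%:R * f j =
    \sum_(j in A) f j - f i + (i == u)%:R * f v.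
Proof.
move=> uA vA iA.
pose g j := ((j \in A)%:R - (j == i)%:R + ((i == u) && (j == v))%:R) * f j.
have -> : \sum_j (two_cliques A u v i j)%:R * f j = \sum_j g j.
  apply: eq_bigr => j _; congr (_ * _); rewrite /= /two_cliques_rel iA.
  have -> : (i == v) = false by apply: contraNF vA => /eqP<-.
  rewrite /= orbF eq_sym; have [->|ji] /= := eqVneq j i.
    have -> : (i == v) = false by apply: contraNF vA => /eqP<-.
    by rewrite iA andbF /=; lra.
  have [->|jv] := eqVneq j v; first by rewrite (negPf vA) andbT /=; lra.
  by rewrite andbF orbF; case: (j \in A) => /=; lra.
rewrite /g; under eq_bigr do rewrite mulrDl mulrBl.
rewrite big_split sumrB /=; congr (_ - _ + _).
- rewrite [RHS]big_mkcond; apply: eq_bigr => j _.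
  by case: (j \in A); rewrite ?mul1r ?mul0r.
- rewrite (bigD1 i) //= eqxx mul1r big1 ?addr0 // => j /negPf->.
  by rewrite mul0r.
- rewrite (bigD1 v) //= eqxx andbT big1 ?addr0 // => j /negPf->.
  by rewrite andbF mul0r.
Qed.

(* The weight vector is a on A \ u, p at u, q at v and b elsewhere. *)
Lemma two_cliques_index_le A u v (a p b q lam rho : R) :
    u \in A -> v \notin A -> alpha <= 1 ->
    0 < a -> 0 < p -> 0 < b -> 0 < q ->
    let s : R := #|A|%:R in let t : R := #|~: A|%:R in
    alpha * a * (s - 1) + (1 - alpha) * (a * (s - 2) + p) <= lam * a ->
    alpha * p * s + (1 - alpha) * (a * (s - 1) + q) <= lam * p ->
    alpha * b * (t - 1) + (1 - alpha) * (b * (t - 2) + q) <= lam * b ->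
    alpha * q * t + (1 - alpha) * (b * (t - 1) + p) <= lam * q ->
  Aalpha_index alpha (two_cliques A u v) rho -> rho <= lam.
Proof.
move=> uA vA a1 a_gt0 p_gt0 b_gt0 q_gt0 s t rowA rowu rowB rowv Grho.
pose w : 'rV[R]_n := \row_j
  if j \in A then if j == u then p else a else if j == v then q else b.
(* Stated for an arbitrary side [B] with end [x]: it is used for [A] with end [u], then for the
   complement with end [v], through [two_cliquesC]. *)
have row_le (B : {set 'I_n}) x y (c r r' : R) i :
    x \in B -> y \notin B -> i \in B ->
    (forall j, j \in B -> w 0 j = if j == x then r else c) -> w 0 y = r' ->
    alpha * c * (#|B|%:R - 1) + (1 - alpha) * (c * (#|B|%:R - 2) + r) <= lam * c ->
    alpha * r * #|B|%:R + (1 - alpha) * (c * (#|B|%:R - 1) + r') <= lam * r ->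
  \sum_j (two_cliques B x y i j)%:R * (alpha * w 0 i + (1 - alpha) * w 0 j)
    <= lam * w 0 i.
  move=> xB yB iB wB wy le_c le_r; rewrite sum_two_cliques // big_split /=.
  rewrite sumr_const -mulr_sumr (bigD1 x) //= (wB x) // eqxx.
  rewrite (eq_bigr (fun=> c)) => [|j /andP[jB /negPf jx]]; last by rewrite wB // jx.
  rewrite (eq_bigl (mem (B :\ x))) => [|j]; last by rewrite !inE andbC.
  rewrite !sumr_const wB // wy (cardsD1 x) xB add1n -?natr1 in le_c le_r *.
  rewrite -[c *+ _]mulr_natr -[_ *+ _.+1]mulr_natr -natr1.
  by case: eqVneq => _ /=; lra.
apply: (largest_eigenvalue_le_weight (w := w) (tr_Aalpha _ _) _ Grho).
- by move=> i j; apply: Aalpha_offdiag_ge0.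
- by move=> i; rewrite mxE; do ![case: ifP => // _].
move=> i; rewrite mulmx_Aalpha; have [iA|iA] := boolP (i \in A).
  apply: (row_le _ _ _ a p q) => //; last by rewrite mxE (negPf vA) eqxx.
  by move=> j jA; rewrite mxE jA.
under eq_bigr do rewrite -two_cliquesC.
apply: (row_le _ _ _ b q p); rewrite ?inE ?uA //; last by rewrite mxE uA eqxx.
by move=> j; rewrite inE mxE => /negPf->.
Qed.

(** This is the row of [u] in the odd case [n = 2K + 1], with [g = 1 - alpha]. The right side minus
    the left side is [h3] plus a third of [h1]. *)
Lemma end_weight_ineq (K g : R) : 5 <= K -> 4^-1 <= g ->
  (1 - g) * ((4 * g + 1) * (K + 1)) * (K + 1) +
    g * (4 * g * (K + 1) * (K + 1 - 1) + 2 * (4 * g + 1)) <=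
  (K + 4^-1) * ((4 * g + 1) * (K + 1)).
Proof.
move=> K5 g_ge.
have h1 : 0 <= g * (4 * g + 1) * (K - 5) by rewrite !mulr_ge0; lra.
have h2 : 0 <= 8 / 3 * g ^+ 2 + 8 / 3 * g - 3 / 4.
  have : 0 <= (g - 4^-1) * (g + 4^-1) by rewrite mulr_ge0; lra.
  by lra.
have h3 : 0 <= (K + 1) * (g * (K - 5) + (8 / 3 * g ^+ 2 + 8 / 3 * g - 3 / 4)).
  have h4 : 0 <= g * (K - 5) by rewrite mulr_ge0; lra.
  by rewrite mulr_ge0; lra.
lra.
Qed.

Lemma balanced_two_cliques_index_le A u v rho : u \in A -> v \notin A ->
    (11 <= n)%N -> #|A| = uphalf n -> 0 <= alpha <= 3 / 4 ->
  Aalpha_index alpha (two_cliques A u v) rho -> rho <= n%:R / 2 - 4^-1.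
Proof.
move=> uA vA n11 cardA /andP[a0 a34] Grho.
have cardB : #|~: A| = n./2 by have := cardsC A; rewrite card_ord cardA; lia.
have [k nE] : {k | n = (odd n + k.*2)%N} by exists n./2; rewrite odd_double_half.
have {}n11 : (11 <= odd n + k.*2)%N by rewrite -nE.
have k5 : 5 <= k%:R :> R by rewrite (ler_nat R 5); lia.
have [nodd|neven] := boolP (odd n).
  have sE : #|A| = k.+1 by lia.
  have tE : #|~: A| = k by lia.
  have -> : n%:R / 2 - 4^-1 = k%:R + 4^-1 :> R.
    suff -> : n%:R = k%:R * 2 + 1 :> R by lra.
    by rewrite nE nodd natrD addrC -muln2 natrM.
  have g_ge : 4^-1 <= 1 - alpha by lra.
  have e_ge0 : 0 <= 4 * (1 - alpha) + 1 by lra.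
  (* These weights make the rows of A \ u tight for lam = k + 1/4. *)
  move: Grho; apply: (two_cliques_index_le (a := 4 * (1 - alpha) * (k%:R + 1))
    (p := (4 * (1 - alpha) + 1) * (k%:R + 1)) (b := 4 * (1 - alpha) + 1)
    (q := 2 * (4 * (1 - alpha) + 1))) => //; rewrite ?sE ?tE.
  - lra.
  - nra.
  - nra.
  - lra.
  - lra.
  - by rewrite le_eqVlt; apply/orP; left; apply/eqP; field.
  - have := end_weight_ineq k5 g_ge; rewrite subKr; lra.
  - have : 0 <= alpha * (4 * (1 - alpha) + 1) by rewrite mulr_ge0.
    lra.
  - lra.
have k6 : 6 <= k%:R :> R.
  by rewrite (ler_nat R 6); move: n11; rewrite (negPf neven); lia.
have sE : #|A| = k by lia.
have tE : #|~: A| = k by lia.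
have -> : n%:R / 2 - 4^-1 = k%:R - 4^-1 :> R.
  suff -> : n%:R = k%:R * 2 :> R by lra.
  by rewrite nE (negPf neven) add0n -muln2 natrM.
(* The critical rows are those of [u] and [v]: they require [(1 - alpha) * (k - 1) >= 3 / 4], which
   follows from [1 - alpha >= 1 / 4] and the bound on [k]. *)
move: Grho; apply: (two_cliques_index_le (a := 2) (p := 3) (b := 2) (q := 3)) => //;
  rewrite ?sE ?tE; nra.
Qed.

End TwoCliquesIndex.

(** * Complements, crossing edges and the extremal graph *)

Lemma degree_complement (T : finType) (G : sgraph T) x :
  (degree G x + degree (complement G) x + 1 = #|T|)%N.
Proof.
rewrite /degree -(cardsC [set y | G x y]) -addnA; congr (_ + _)%N.
rewrite (cardsD1 x (~: _)) !inE adj_irrefl addnC; congr (_ + _)%N.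
by apply: eq_card => y; rewrite !inE [y == x]eq_sym.
Qed.

(** A triangle of the complement is a stable set of three vertices. *)
Lemma triangle_free_complement (T : finType) (G : sgraph T) :
  independence_number G = 2%N -> triangle_free (complement G).
Proof.
move=> indG x y z /andP[xy Gxy] /andP[yz Gyz]; apply/negP => /andP[xz Gxz].
have : (#|[set x; y; z]| <= 2)%N.
  rewrite -indG; apply: leq_bigmax_cond; apply/forall_inP => a aS.
  apply/forall_inP => b; move: aS; rewrite !inE.
  by move=> /orP[/orP[]|]/eqP-> /orP[/orP[]|]/eqP->;
    rewrite ?adj_irrefl // adj_sym.
by rewrite -setUA !cardsU1 !inE cards1 negb_or xy xz yz.
Qed.

Lemma exists_set_of_card (T : finType) k : (k <= #|T|)%N ->
  exists A : {set T}, #|A| = k.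
Proof.
move=> le_k; have [f f_inj] : exists f : 'I_k -> T, injective f.
  exists (fun i => enum_val (widen_ord le_k i)) => i j /enum_val_inj.
  by move=> /(congr1 val) /= /val_inj.
by exists [set f i | i in 'I_k]; rewrite card_imset // card_ord.
Qed.

Lemma Aalpha_index_exists (R : realType) n (alpha : R) (G : sgraph 'I_n) :
  (0 < n)%N -> exists rho, Aalpha_index alpha G rho.
Proof.
by move=> n0; have [rho] := largest_eigenvalue_exists n0 (tr_Aalpha alpha G); exists rho.
Qed.

Lemma connected_crossing_edge (T : finType) (G : sgraph T) (A : {set T}) x y :
  connected G -> x \in A -> y \notin A ->
  exists u v, [/\ u \in A, v \notin A & G u v].
Proof.
move=> conG xA yA; have [/existsP[u /existsP[v /and3P[uA vA uv]]]|none] :=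
  boolP [exists u, [exists v, [&& u \in A, v \notin A & G u v]]]; first by exists u, v.
have clA : closed G A.
  apply: intro_closed => [|u v uv uA]; first exact/sym_connect_sym/adj_sym.
  apply: contraNT none => vA; apply/existsP; exists u; apply/existsP; exists v.
  by rewrite uA vA.
by have := closed_connect clA (conG x y); rewrite xA (negPf yA).
Qed.

Theorem theorem1p4 (R : realType) (n : nat) (alpha : R) (G : sgraph 'I_n) :
  (11 <= n)%N ->
  0 <= alpha <= 3 / 4 ->
  minimizes_Aalpha_index alpha
    (fun H : sgraph 'I_n => connected H /\ independence_number H = 2%N) G ->
  isomorphic G (F (uphalf n) n./2).
Proof.
move=> n11 alphaP [[conG indG] [rho Grho rho_min]].
have /andP[a0 a34] := alphaP.
have n0 : (0 < n)%N by lia.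
have rho_le_two_cliques (A : {set 'I_n}) u v mu :
    #|A| = uphalf n -> u \in A -> v \notin A ->
    Aalpha_index alpha (two_cliques A u v) mu -> rho <= mu.
  move=> cardA uA vA; apply: rho_min; split; first exact: connected_two_cliques.
  by apply: independence_number_two_cliques => //; lia.
have rho_le : rho <= n%:R / 2 - 4^-1.
  have [|A cardA] := @exists_set_of_card 'I_n (uphalf n); first by rewrite card_ord; lia.
  have [u uA] : exists u, u \in A by apply/card_gt0P; lia.
  have [v] : exists v, v \in ~: A.
    by apply/card_gt0P; have := cardsC A; rewrite card_ord; lia.
  rewrite inE => vA; have [mu Fmu] := Aalpha_index_exists alpha (two_cliques A u v) n0.
  by apply: le_trans (rho_le_two_cliques _ _ _ _ cardA uA vA Fmu) _;
    exact: balanced_two_cliques_index_le Fmu.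
have n11R : 11 <= n%:R :> R by rewrite (ler_nat R 11).
have [[A0 bipA0]|few] :=
  triangle_free_dichotomy (triangle_free_complement indG); last first.
  have sum_deg : (\sum_x degree G x + \sum_x degree (complement G) x + n = n * n)%N.
    rewrite -[X in (_ + X = _)%N]card_ord -sum1_card -!big_split /=.
    rewrite (eq_bigr (fun=> n)) => [|x _]; last by rewrite degree_complement card_ord.
    by rewrite sum_nat_const card_ord.
  have := sum_degree_le_index Grho; move: few sum_deg; rewrite card_ord.
  move: (\sum_x degree G x)%N (\sum_x degree _ x)%N => S Sc few sum_deg S_le.
  have : (n * n <= 2 * S + 5)%N.
    by move: n11 few sum_deg; clear; case: n => // m; rewrite subn1 /=; nia.
  (* Together with [S <= rho * n] and [rho <= n / 2 - 1 / 4], this would force [n <= 10]. *)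
  rewrite -(ler_nat R) natrD !natrM; nra.
have [A [cardA bipA]] : exists A : {set 'I_n}, (#|~: A| <= #|A|)%N /\
    bipartition (complement G) A.
  have [leA|ltA] := leqP #|~: A0| #|A0|; first by exists A0.
  exists (~: A0); rewrite setCK; split; first exact: ltnW.
  by move=> x y /bipA0; rewrite !inE (inj_eq negb_inj).
have cliqueG x y : x != y -> (x \in A) = (y \in A) -> G x y.
  move=> xy eq_xy; apply: contraTT isT => Gxy.
  by have := bipA x y; rewrite /= xy Gxy eq_xy eqxx => /(_ isT).
have A_gt0 : A != set0.
  by rewrite -card_gt0; have := cardsC A; rewrite card_ord; lia.
have cardA_eq : #|A| = uphalf n.
  have A_le : #|A|%:R <= rho + 1.
    apply: clique_le_index Grho A_gt0 _; first by rewrite a0 /=; lra.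
    by move=> x y xA yA xy; apply: cliqueG; rewrite ?xA ?yA.
  have [big|small] := ltnP (uphalf n) #|A|; last first.
    by have := cardsC A; rewrite card_ord; lia.
  (* A larger side would give [rho >= #|A| - 1 >= n / 2], against [rho_le]. *)
  have : (n + 2)%:R <= (2 * #|A|)%:R :> R by rewrite ler_nat; lia.
  by rewrite natrD natrM => big_R; exfalso; lra.
have cardB : #|~: A| = n./2 by have := cardsC A; rewrite card_ord; lia.
have [x xA] := set0Pn _ A_gt0.
have [y] : exists y, y \in ~: A by apply/card_gt0P; lia.
rewrite inE => yA; have [u [v [uA vA uv]]] := connected_crossing_edge conG xA yA.
have subG : subrel (two_cliques A u v) G.
  move=> a b /andP[ab /or3P[/eqP|/andP[/eqP-> /eqP->] //|/andP[/eqP-> /eqP->]]].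
    exact: cliqueG.
  by rewrite adj_sym.
have [eqG|/forallPn[p /forallPn[q]]] :=
  boolP [forall p, forall q, G p q ==> two_cliques A u v p q]; last first.
  (* An edge of [G] beyond those of [two_cliques A u v] would make the index of [G] strictly larger
     than that of this competitor, against minimality. *)
  rewrite negb_imply => /andP[Gpq npq].
  have [mu Fmu] := Aalpha_index_exists alpha (two_cliques A u v) n0.
  have := rho_le_two_cliques _ _ _ _ cardA_eq uA vA Fmu.
  rewrite leNgt (index_lt_subgraph _ _ subG Gpq npq Fmu Grho) //.
    by rewrite a0 /=; lra.
  exact: connected_two_cliques.
have [f f_bij fE] := isomorphic_two_cliques uA vA.
rewrite -cardA_eq -cardB; exists f => // a b; rewrite fE.
by apply/idP/idP => [/subG//|ab]; exact: (implyP (forallP (forallP eqG a) b)).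
Qed.
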